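(* There is a constant $\kappa>0$ such that the following holds for all positive integers $n,m$, all $\epsilon>0$, every real symmetric positive definite $n\times n$ matrix $C$ and every real $m\times n$ matrix $A$. If $U$ is a random element of the orthogonal group $O(n)$ distributed according to the Haar probability measure, then with probability at least $1-\exp(-\kappa(n-1)\epsilon^2)$, $$\left|\tau_m(AUCU^TA^T)-\tau_n(C)\,\tau_m(AA^T)\right|\le 2\epsilon\,\|C\|\,\|AA^T\|.$$ The constant $\kappa$ is independent of $C,A,n,m,\epsilon$.
   Context: For a square $k\times k$ matrix $B$, $\tau_k(B):=\operatorname{tr}(B)/k$ denotes the renormalized trace. $\|B\|:=\max_{\|x\|=1}\|Bx\|$ denotes the operator norm with respect to the Euclidean norm. *)

(* Defs.v *)
From HB Require Import structures.
From mathcomp Require Import all_boot all_order all_algebra.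
From mathcomp Require Import all_classical all_reals all_analysis.

Set Implicit Arguments.
Unset Strict Implicit.
Unset Printing Implicit Defensive.

Import Order.TTheory GRing.Theory Num.Theory.
Import numFieldNormedType.Exports.

Local Open Scope classical_set_scope.
Local Open Scope ring_scope.

Definition ntrace (R : realType) (k : nat) (B : 'M[R]_k) : R := \tr B / k%:R.

Definition enorm (R : realType) (k : nat) (x : 'cV[R]_k) : R :=
  Num.sqrt (\sum_(i < k) x i 0 ^+ 2).

(* The library's norm `|B| on matrices is the largest absolute value of an
   entry, not the operator norm. For 0 < k the supremum below is a maximum, by
   compactness of the unit sphere. *)
Definition opnorm (R : realType) (k : nat) (B : 'M[R]_k) : R :=
  sup [set enorm (B *m x) | x in [set x : 'cV[R]_k | enorm x = 1]].

Definition symposdef (R : realType) (k : nat) (C : 'M[R]_k) : Prop :=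
  C^T = C /\ forall x : 'cV[R]_k, x != 0 -> 0 < (x^T *m C *m x) 0 0.

Definition orthogonal_group (R : realType) (n : nat) : set 'M[R]_n :=
  [set Q | Q^T *m Q = 1%:M].

(* Matrices with their Borel sigma-algebra; the topology on 'M[R]_n is the
   product topology, i.e. the Euclidean one. *)
Notation borelM R n := (g_sigma_algebraType (@open 'M[R]_n)).

(* The Borel sets of O(n) are the traces on O(n) of those of 'M[R]_n, so a Borel
   probability measure on O(n) is encoded as one on 'M[R]_n carried by O(n). *)
Definition is_haar_orthogonal (R : realType) (n : nat)
    (mu : probability (borelM R n) R) : Prop :=
  mu (@orthogonal_group R n) = 1%E /\
  forall (Q : 'M[R]_n) (B : set (borelM R n)),
    orthogonal_group Q -> measurable B ->
    mu [set Q *m (V : 'M[R]_n) | V in B] = mu B.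

(* Main.v *)
(* With M = A^T A and X = V C V^T, the quantity to control is, up to the factor
   1/m, f(V) = tr(M X) - tr M tr C / n on O(n). Rotating V by a small angle in
   every coordinate plane, invariance of Haar measure gives the integration by
   parts formula  4n E[f g(f)] = E[|grad f|^2 g'(f)],  where 4n is the Casimir
   eigenvalue of f and |grad f|^2 <= 16 ||C||^2 tr(M^2).  Taking for g an odd
   ramp rising from level a to level b, one gets, with G(t) = P(|f| > t),
     4n b (b - a) G(b) <= 16 ||C||^2 tr(M^2) (G(a) - G(b)),
   and iterating along equally spaced levels gives Gaussian decay of G starting
   from G(0) <= 1, hence without a multiplicative constant in front. *)
Require Import Defs.
From HB Require Import structures.
From mathcomp Require Import all_boot all_order all_algebra.
From mathcomp Require Import all_classical all_reals all_analysis.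
From mathcomp Require Import measurable_realfun ring lra.

Set Implicit Arguments.
Unset Strict Implicit.
Unset Printing Implicit Defensive.

Import Order.TTheory GRing.Theory Num.Theory.
Import numFieldNormedType.Exports.

Local Open Scope classical_set_scope.
Local Open Scope ring_scope.

(** * Euclidean, operator and Frobenius norms *)

(** Invariance of Haar measure is the only analytic input, so nothing is differentiated on O(n).
    Every plane rotation preserves the measure, hence integration by parts is an exact identity
    between finite differences at each angle. A rotation is quadratic in its generator, so along it
    the observable is a polynomial in s = sin theta and u = 1 - cos theta. The remainders are
    bounded uniformly over O(n), where entries are at most 1 in absolute value, and s tends to 0
    only after integration. Finite differences also admit the piecewise linear ramp, at the price of
    a margin around its kinks.

    The observable is an eigenfunction because it is linear in the traceless symmetric part of V C
    V^T, on which the sum over planes acts by a scalar. Planes are indexed by ordered pairs: this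
    doubles both the eigenvalue and the gradient bound relative to unordered pairs, and cancels in
    the decay rate. *)

Definition sqfrob (R : realType) (m n : nat) (B : 'M[R]_(m, n)) : R :=
  \sum_i \sum_j B i j ^+ 2.

Lemma sqfrob_trace (R : realType) (m n : nat) (B : 'M[R]_(m, n)) :
  sqfrob B = \tr (B^T *m B).
Proof.
rewrite /sqfrob /mxtrace exchange_big /=; apply: eq_bigr => j _.
by rewrite mxE; apply: eq_bigr => i _; rewrite !mxE expr2.
Qed.

Lemma sqfrob_ge0 (R : realType) (m n : nat) (B : 'M[R]_(m, n)) :
  0 <= sqfrob B.
Proof. by do 2 (apply: sumr_ge0 => ? _); exact: sqr_ge0. Qed.

Lemma sqfrob_eq0 (R : realType) (m n : nat) (B : 'M[R]_(m, n)) :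
  sqfrob B = 0 -> B = 0.
Proof.
move=> /eqP; rewrite /sqfrob psumr_eq0; last first.
  by move=> i _; apply: sumr_ge0 => j _; exact: sqr_ge0.
move=> /allP B0; apply/matrixP => i j; rewrite mxE.
have := B0 i (mem_index_enum i); rewrite psumr_eq0; last first.
  by move=> k _; exact: sqr_ge0.
by move=> /allP /(_ j (mem_index_enum j)); rewrite sqrf_eq0 => /eqP.
Qed.

Lemma sqr_enorm (R : realType) (k : nat) (x : 'cV[R]_k) :
  enorm x ^+ 2 = sqfrob x.
Proof.
rewrite /enorm /sqfrob sqr_sqrtr; last by apply: sumr_ge0 => i _; exact: sqr_ge0.
by apply: eq_bigr => i _; rewrite big_ord1.
Qed.

Lemma enorm_ge0 (R : realType) (k : nat) (x : 'cV[R]_k) : 0 <= enorm x.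
Proof. exact: sqrtr_ge0. Qed.

Lemma enormZ (R : realType) (k : nat) (a : R) (x : 'cV[R]_k) :
  0 <= a -> enorm (a *: x) = a * enorm x.
Proof.
move=> a0; rewrite /enorm.
under eq_bigr do rewrite mxE exprMn.
by rewrite -mulr_sumr sqrtrM ?sqr_ge0// sqrtr_sqr ger0_norm.
Qed.

Lemma enorm_delta (R : realType) (k : nat) (i : 'I_k) :
  enorm (delta_mx i 0 : 'cV[R]_k) = 1.
Proof.
rewrite /enorm (bigD1 i)//= big1 => [|j ji]; rewrite mxE ?eqxx ?expr1n ?addr0 ?sqrtr1//.
by rewrite (negbTE ji) expr0n.
Qed.

Lemma orthogonal_group_tr (R : realType) (n : nat) (V : 'M[R]_n) :
  orthogonal_group V -> V *m V^T = 1%:M.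
Proof. exact: mulmx1C. Qed.

Lemma sqfrob_mul_orthogonal (R : realType) (m n : nat) (V : 'M[R]_m)
    (B : 'M[R]_(m, n)) :
  orthogonal_group V -> sqfrob (V *m B) = sqfrob B.
Proof.
move=> VV; rewrite !sqfrob_trace trmx_mul -mulmxA (mulmxA V^T).
by rewrite (VV : _ = _) mul1mx.
Qed.

Lemma entry_le_enorm (R : realType) (k : nat) (x : 'cV[R]_k) (i : 'I_k) :
  `|x i 0| <= enorm x.
Proof.
rewrite -sqrtr_sqr; apply: ler_wsqrtr; rewrite (bigD1 i)//= lerDl.
by apply: sumr_ge0 => j _; exact: sqr_ge0.
Qed.

Lemma enorm_le_sum (R : realType) (k : nat) (x : 'cV[R]_k) :
  enorm x <= \sum_i `|x i 0|.
Proof.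
have s0 : 0 <= \sum_i `|x i 0| by apply: sumr_ge0.
rewrite -(ger0_norm s0) -sqrtr_sqr; apply: ler_wsqrtr.
rewrite expr2 mulr_suml; apply: ler_sum => i _.
rewrite -real_normK ?num_real// expr2; apply: ler_wpM2l => //.
by rewrite (bigD1 i)//= lerDl sumr_ge0.
Qed.

(** [sup] of an unbounded set is a default value, so every use of [opnorm] as an upper bound rests
    on this. Unit vectors have entries at most 1 in absolute value. *)
Lemma has_ub_opnorm (R : realType) (k : nat) (B : 'M[R]_k) :
  has_ubound [set enorm (B *m x) | x in [set x : 'cV[R]_k | enorm x = 1]].
Proof.
exists (\sum_i \sum_j `|B i j|) => _ [x /= x1 <-].
apply: le_trans (enorm_le_sum _) _; apply: ler_sum => i _.
rewrite mxE; apply: le_trans (ler_norm_sum _ _ _) _; apply: ler_sum => j _.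
by rewrite normrM ler_piMr// -x1 entry_le_enorm.
Qed.

Lemma enorm_mul_le (R : realType) (k : nat) (B : 'M[R]_k) (x : 'cV[R]_k) :
  enorm (B *m x) <= opnorm B * enorm x.
Proof.
have [x0|x0] := eqVneq (enorm x) 0.
  have /eqP : enorm x ^+ 2 = 0 by rewrite x0 expr0n.
  rewrite sqr_enorm => /eqP /sqfrob_eq0 ->.
  rewrite mulmx0; have -> : (0 : 'cV[R]_k) = 0 *: 0 by rewrite scaler0.
  by rewrite enormZ// mul0r mulr0.
have xp : 0 < enorm x by rewrite lt_def x0 enorm_ge0.
rewrite -ler_pdivrMr// mulrC -enormZ ?invr_ge0 ?enorm_ge0// scalemxAr.
apply: ub_le_sup; first exact: has_ub_opnorm.
exists ((enorm x)^-1 *: x) => //=.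
by rewrite enormZ ?invr_ge0 ?enorm_ge0// mulVf.
Qed.

Lemma opnorm_ge0 (R : realType) (k : nat) (B : 'M[R]_k) :
  (0 < k)%N -> 0 <= opnorm B.
Proof.
move=> k0; have := enorm_mul_le B (delta_mx (Ordinal k0) 0).
by rewrite enorm_delta mulr1; apply: le_trans; exact: enorm_ge0.
Qed.

Lemma sqfrob_col (R : realType) (m n : nat) (B : 'M[R]_(m, n)) :
  sqfrob B = \sum_j enorm (col j B) ^+ 2.
Proof.
rewrite /sqfrob exchange_big; apply: eq_bigr => j _ /=.
rewrite sqr_enorm /sqfrob; apply: eq_bigr => i _.
by rewrite big_ord1 mxE.
Qed.

Lemma sqfrob_mul_le (R : realType) (k n : nat) (B : 'M[R]_k) (N : 'M[R]_(k, n)) :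
  sqfrob (B *m N) <= opnorm B ^+ 2 * sqfrob N.
Proof.
rewrite !sqfrob_col mulr_sumr; apply: ler_sum => j _.
rewrite !colE -mulmxA -exprMn ler_sqr ?nnegrE ?enorm_ge0 ?enorm_mul_le//.
exact: le_trans (enorm_ge0 _) (enorm_mul_le _ _).
Qed.

(** Multiply the identity, whose squared Frobenius norm is k. This supplies the factor m in the
    final gradient bound and shows that a zero operator norm forces a zero matrix. *)
Lemma sqfrob_le_opnorm (R : realType) (k : nat) (B : 'M[R]_k) :
  sqfrob B <= k%:R * opnorm B ^+ 2.
Proof.
have := sqfrob_mul_le B 1%:M; rewrite mulmx1 mulrC.
by rewrite (sqfrob_trace 1%:M) trmx1 mulmx1 mxtrace1.
Qed.

Lemma mx_entries_bounded (R : realType) (m n : nat) (N : 'M[R]_(m, n)) :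
  exists2 b : R, 0 <= b & forall i j, `|N i j| <= b.
Proof.
exists (\sum_i \sum_j `|N i j|); first by do 2 (apply: sumr_ge0 => ? _).
move=> i j; rewrite (bigD1 i)//= (bigD1 j)//= -addrA lerDl.
by rewrite addr_ge0// ?sumr_ge0// => k _; rewrite sumr_ge0.
Qed.

(** * Rotations in coordinate planes *)

(* E_ij - E_ji, which is 0 when i = j: sums over all pairs (i, j) may include
   the diagonal. *)
Definition plane_gen (R : realType) (n : nat) (i j : 'I_n) : 'M[R]_n :=
  delta_mx i j - delta_mx j i.

(** With [delta_mx i j] written as e_i e_j^T, the middle of the product collapses to the scalar
    e_j^T X e_k. *)
Lemma mul_delta_delta (R : realType) (n : nat) (i j k l : 'I_n) (X : 'M[R]_n) :
  delta_mx i j *m X *m delta_mx k l = X j k *: delta_mx i l.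
Proof.
rewrite -(mul_delta_mx (0 : 'I_1) i j) -(mul_delta_mx (0 : 'I_1) k l).
rewrite -!mulmxA (mulmxA _ X) (mulmxA (_ *m X)) -rowE -colE.
have -> : col k (row j X) = (X j k)%:M.
  by apply/matrixP => a b; rewrite !ord1 !mxE eqxx.
by rewrite mul_scalar_mx -scalemxAr mul_delta_mx.
Qed.

Lemma plane_gen_tr (R : realType) (n : nat) (i j : 'I_n) :
  (plane_gen R i j)^T = - plane_gen R i j.
Proof. by rewrite /plane_gen linearB/= !trmx_delta opprB. Qed.

Lemma plane_gen_sandwich (R : realType) (n : nat) (i j : 'I_n) (X : 'M[R]_n) :
  plane_gen R i j *m X *m plane_gen R i j =
  X j i *: delta_mx i j - X j j *: delta_mx i i
  - X i i *: delta_mx j j + X i j *: delta_mx j i.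
Proof.
rewrite /plane_gen mulmxBl mulmxBr !mulmxBl !mul_delta_delta.
by apply/matrixP => a b; rewrite !mxE; ring.
Qed.

(** The generator is a quarter turn of its plane and vanishes on the orthogonal complement; for i =
    j it is 0. This relation is what makes its exponential quadratic in it. *)
Lemma plane_gen_cube (R : realType) (n : nat) (i j : 'I_n) :
  plane_gen R i j *m plane_gen R i j *m plane_gen R i j = - plane_gen R i j.
Proof.
rewrite plane_gen_sandwich /plane_gen !mxE !eqxx.
have [->|ij] := eqVneq i j; first by rewrite !(subrr, scale0r, oppr0, addr0).
rewrite /= !(subrr, sub0r, subr0, scale0r, addr0) scaleN1r scale1r.
by rewrite opprB addrC.
Qed.

(** Source of the Casimir eigenvalue: in [plane_gen_sandwich] the two off-diagonal terms each sum to
    X^T and the two diagonal ones each to the trace. *)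
Lemma sum_plane_gen_sandwich (R : realType) (n : nat) (X : 'M[R]_n) :
  \sum_i \sum_j plane_gen R i j *m X *m plane_gen R i j = (X^T - (\tr X)%:M) *+ 2.
Proof.
have S1 : \sum_i \sum_j X j i *: delta_mx i j = X^T.
  rewrite [RHS]matrix_sum_delta; apply: eq_bigr => i _.
  by apply: eq_bigr => j _; rewrite mxE.
have S2 : \sum_i \sum_j X i j *: delta_mx j i = X^T.
  by rewrite exchange_big.
have S3 : \sum_i \sum_j X i i *: delta_mx j j = (\tr X)%:M :> 'M[R]_n.
  rewrite -scalemx1 mx1_sum_delta scaler_suml.
  by apply: eq_bigr => i _; rewrite scaler_sumr.
have S4 : \sum_i \sum_j X j j *: delta_mx i i = (\tr X)%:M :> 'M[R]_n.
  by rewrite exchange_big.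
under eq_bigr do under eq_bigr do rewrite plane_gen_sandwich.
under eq_bigr do rewrite big_split !sumrB /=.
rewrite big_split !sumrB /= S1 S2 S3 S4.
by apply/matrixP => a b; rewrite !mxE; ring.
Qed.

Lemma sum_plane_gen_sqr (R : realType) (n : nat) :
  \sum_i \sum_j plane_gen R i j *m plane_gen R i j = ((1 - n%:R) *+ 2)%:M :> 'M[R]_n.
Proof.
have := sum_plane_gen_sandwich (1%:M : 'M[R]_n).
under eq_bigr do under eq_bigr do rewrite mulmx1.
move=> ->; apply/matrixP => a b; rewrite trmx1 mxtrace1 !mxE.
by case: (a == b); rewrite ?mulr1n ?mulr0n; ring.
Qed.

(* Rodrigues' formula for exp(theta plane_gen), with s = sin theta and
   u = 1 - cos theta. *)
Definition plane_rot (R : realType) (n : nat) (s u : R) (i j : 'I_n) : 'M[R]_n :=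
  1%:M + s *: plane_gen R i j + u *: (plane_gen R i j *m plane_gen R i j).

Lemma plane_rot_tr (R : realType) (n : nat) (s u : R) (i j : 'I_n) :
  (plane_rot s u i j)^T = plane_rot (- s) u i j.
Proof.
rewrite /plane_rot; have := plane_gen_tr R i j; move: (plane_gen R i j) => A AT.
rewrite !linearD/= !linearZ/= trmx1 trmx_mul AT mulmxN mulNmx opprK.
by rewrite scalerN scaleNr.
Qed.

(** The hypothesis is sin^2 + cos^2 = 1. After reduction by A^3 = - A, the product with the
    transpose is 1 + (2 u - s^2 - u^2) A^2. *)
Lemma plane_rot_orthogonal (R : realType) (n : nat) (s u : R) (i j : 'I_n) :
  s ^+ 2 = 2 * u - u ^+ 2 -> orthogonal_group (plane_rot s u i j).
Proof.
move=> su; rewrite /orthogonal_group /= plane_rot_tr /plane_rot.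
have := plane_gen_cube R i j; move: (plane_gen R i j) => A A3'.
set A2 := A *m A in A3' *; have A3 : A *m A2 = - A by rewrite mulmxA.
have A4 : A2 *m A2 = - A2 by rewrite -mulmxA A3 mulmxN.
rewrite !(mulmxDl, mulmxDr, mul1mx, mulmx1) -!scalemxAl -!scalemxAr A3 A3' A4.
rewrite -/A2; apply/matrixP => a b; rewrite !mxE.
by ring: su.
Qed.

(** * The observable along a plane rotation *)

(** For X = V C V^T, [btr M X Q Q] is the trace term of the observable at Q V. Keeping the two
    occurrences of Q apart makes the form bilinear, so that a rotation can be expanded term by
    term. *)
Definition btr (R : realType) (n : nat) (M X P S : 'M[R]_n) : R :=
  \tr (M *m P *m X *m S^T).

Lemma btr_rot (R : realType) (n : nat) (M X : 'M[R]_n) (s u : R) (i j : 'I_n) :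
  let A := plane_gen R i j in let A2 := A *m A in let I := 1%:M in
  btr M X (plane_rot s u i j) (plane_rot s u i j) =
  btr M X I I + s * (btr M X A I + btr M X I A)
  + u * (btr M X A2 I + btr M X I A2) + s ^+ 2 * btr M X A A
  + s * u * (btr M X A A2 + btr M X A2 A) + u ^+ 2 * btr M X A2 A2.
Proof.
rewrite /plane_rot /btr; move: (plane_gen R i j) => A; set A2 := A *m A => /=.
have -> : (1%:M + s *: A + u *: A2)^T = 1%:M^T + s *: A^T + u *: A2^T.
  by apply/matrixP => a b; rewrite !mxE.
move: (1%:M^T) (A^T) (A2^T) => I' A' A2'.
rewrite !(mulmxDl, mulmxDr) -!(scalemxAr, scalemxAl) !mxtraceD !mxtraceZ.
ring.
Qed.

Lemma mxtrace_sum (R : realType) (n : nat) (I : finType) (F : I -> 'M[R]_n) :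
  \tr (\sum_i F i) = \sum_i \tr (F i).
Proof. exact: raddf_sum. Qed.

Lemma sum_btr_plane_gen_sandwich (R : realType) (n : nat) (M X : 'M[R]_n) :
  X^T = X ->
  \sum_i \sum_j btr M X (plane_gen R i j) (plane_gen R i j) =
  (\tr M * \tr X - \tr (M *m X)) *+ 2.
Proof.
move=> XT.
transitivity (- \tr (M *m \sum_i \sum_j plane_gen R i j *m X *m plane_gen R i j)).
  rewrite mulmx_sumr mxtrace_sum -sumrN; apply: eq_bigr => i _.
  rewrite mulmx_sumr mxtrace_sum -sumrN; apply: eq_bigr => j _.
  by rewrite /btr plane_gen_tr mulmxN raddfN /= !mulmxA.
rewrite sum_plane_gen_sandwich XT -scaler_nat -scalemxAr mxtraceZ mulmxBr raddfB /=.
by rewrite -(scalemx1 _ (\tr X)) -scalemxAr mulmx1 mxtraceZ; ring.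
Qed.

Lemma sum_btr_plane_gen_sqr (R : realType) (n : nat) (M X : 'M[R]_n) :
  \sum_i \sum_j (btr M X (plane_gen R i j *m plane_gen R i j) 1%:M
                 + btr M X 1%:M (plane_gen R i j *m plane_gen R i j)) =
  (1 - n%:R) *+ 4 * \tr (M *m X).
Proof.
transitivity (\tr (M *m (\sum_i \sum_j plane_gen R i j *m plane_gen R i j) *m X)
   + \tr (M *m X *m (\sum_i \sum_j plane_gen R i j *m plane_gen R i j))).
  rewrite !mulmx_sumr mulmx_suml !mxtrace_sum -big_split; apply: eq_bigr => i _ /=.
  rewrite !mulmx_sumr mulmx_suml !mxtrace_sum -big_split; apply: eq_bigr => j _ /=.
  rewrite /btr /= trmx1 !mulmx1 trmx_mul !plane_gen_tr mulmxN mulNmx opprK.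
  by rewrite !mulmxA.
rewrite sum_plane_gen_sqr -(scalemx1 _ (_ *+ 2)) -!scalemxAr -scalemxAl !mulmx1.
by rewrite !mxtraceZ; ring.
Qed.

(** Terms odd in s cancel between a rotation and its inverse. Substituting 2 u = s^2 + u^2, the
    coefficient of s^2 is 4 (n - 1) tr(M X) - 4 (tr M tr X - tr(M X)), that is, 4 n times the
    observable; what is left carries u^2, of order s^4. *)
Lemma sum_btr_rot (R : realType) (n : nat) (M X : 'M[R]_n) (s u : R) :
  (0 < n)%N -> X^T = X -> s ^+ 2 = 2 * u - u ^+ 2 ->
  \sum_i \sum_j (btr M X 1%:M 1%:M *+ 2
     - btr M X (plane_rot s u i j) (plane_rot s u i j)
     - btr M X (plane_rot (- s) u i j) (plane_rot (- s) u i j)) =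
  s ^+ 2 * (4 * n%:R) * (\tr (M *m X) - \tr M * \tr X / n%:R)
  + u ^+ 2 * (4 * (n%:R - 1) * \tr (M *m X)
     - 2 * \sum_i \sum_j btr M X (plane_gen R i j *m plane_gen R i j)
                                 (plane_gen R i j *m plane_gen R i j)).
Proof.
move=> n0 XT su.
have n0' : n%:R != 0 :> R by rewrite pnatr_eq0 -lt0n.
transitivity (- (2 * u) *
    (\sum_i \sum_j (btr M X (plane_gen R i j *m plane_gen R i j) 1%:M
                 + btr M X 1%:M (plane_gen R i j *m plane_gen R i j)))
  - 2 * s ^+ 2 * (\sum_i \sum_j btr M X (plane_gen R i j) (plane_gen R i j))
  - 2 * u ^+ 2 * (\sum_i \sum_j btr M X (plane_gen R i j *m plane_gen R i j)
                                 (plane_gen R i j *m plane_gen R i j))).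
  rewrite !mulr_sumr -!sumrB; apply: eq_bigr => i _.
  rewrite !mulr_sumr -!sumrB; apply: eq_bigr => j _.
  by rewrite !btr_rot /=; ring.
rewrite sum_btr_plane_gen_sqr sum_btr_plane_gen_sandwich//.
have -> : 2 * u = s ^+ 2 + u ^+ 2 by rewrite su; ring.
by field.
Qed.

(** The derivative along a generator A is tr([X, M] A), so with Y = X M the gradient has entries 2
    (Y_ji - Y_ij). Its square is at most 8 (Y_ji^2 + Y_ij^2), and each entry of Y is met twice. *)
Lemma sum_btr_grad (R : realType) (n : nat) (M X : 'M[R]_n) :
  X^T = X -> M^T = M ->
  \sum_i \sum_j (btr M X (plane_gen R i j) 1%:M + btr M X 1%:M (plane_gen R i j)) ^+ 2
  <= 16 * sqfrob (X *m M).
Proof.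
move=> XT MT.
have trd (Z : 'M[R]_n) i j : \tr (Z *m delta_mx i j) = Z j i.
  rewrite /mxtrace (bigD1 j)//= big1 => [|k kj]; rewrite mxE (bigD1 i)//= big1 ?addr0.
  - by rewrite mxE !eqxx mulr1.
  - by move=> l li; rewrite mxE (negbTE li) mulr0.
  - by rewrite mxE (negbTE kj) andbF mulr0.
  - by move=> l li; rewrite mxE (negbTE li) mulr0.
pose Y := X *m M.
have MX : M *m X = Y^T by rewrite trmx_mul XT MT.
have gradE i j : btr M X (plane_gen R i j) 1%:M + btr M X 1%:M (plane_gen R i j) =
    (Y j i - Y i j) *+ 2.
  rewrite /btr trmx1 !mulmx1 plane_gen_tr.
  have -> : \tr (M *m plane_gen R i j *m X) = \tr (Y *m plane_gen R i j).
    by rewrite mxtrace_mulC mulmxA.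
  rewrite MX mulmxN /plane_gen !mulmxBr raddfN !raddfB /= !trd !mxE; ring.
under eq_bigr do under eq_bigr do rewrite gradE.
apply: (@le_trans _ _ (\sum_i \sum_j (8 * Y j i ^+ 2 + 8 * Y i j ^+ 2))).
  apply: ler_sum => i _; apply: ler_sum => j _.
  by have := sqr_ge0 (Y j i + Y i j); nra.
under eq_bigr do rewrite big_split /=.
rewrite big_split /= [X in X + _]exchange_big /=.
rewrite -/(sqfrob _); under eq_bigr do rewrite -mulr_sumr.
by rewrite -mulr_sumr /sqfrob -/Y; lra.
Qed.

(** * Bounds uniform over O(n) *)

Lemma mulmx_entry_le (R : realType) (m n p : nat) (B : 'M[R]_(m, n))
    (N : 'M[R]_(n, p)) (b c : R) :
  0 <= b ->
  (forall i j, `|B i j| <= b) -> (forall i j, `|N i j| <= c) ->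
  forall i j, `|(B *m N) i j| <= n%:R * (b * c).
Proof.
move=> b0 Bb Nc i j; rewrite mxE.
apply: le_trans (ler_norm_sum _ _ _) _.
have -> : n%:R * (b * c) = \sum_(k < n) b * c.
  by rewrite sumr_const card_ord mulr_natl.
by apply: ler_sum => k _; rewrite normrM ler_pM.
Qed.

(** A crude bound suffices: it only enters error terms that disappear as s tends to 0. *)
Lemma btr_le (R : realType) (n : nat) (M X P S : 'M[R]_n) (m x c : R) :
  0 <= m -> 0 <= x -> 0 <= c ->
  (forall i j, `|M i j| <= m) -> (forall i j, `|X i j| <= x) ->
  (forall i j, `|P i j| <= c) -> (forall i j, `|S i j| <= c) ->
  `|btr M X P S| <= n%:R ^+ 4 * (m * x * c ^+ 2).
Proof.
move=> m0 x0 c0 Mm Xx Pc Sc; rewrite /btr /mxtrace.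
apply: le_trans (ler_norm_sum _ _ _) _.
have n0 : 0 <= n%:R :> R by [].
apply: (@le_trans _ _ (\sum_(i < n) n%:R * (n%:R * (n%:R * (m * c) * x) * c))).
  apply: ler_sum => i _; apply: mulmx_entry_le; first by rewrite !mulr_ge0.
    apply: mulmx_entry_le; first by rewrite !mulr_ge0.
      exact: mulmx_entry_le.
    exact: Xx.
  by move=> k l; rewrite mxE.
by rewrite sumr_const card_ord -mulr_natl; lra.
Qed.

Lemma plane_gen_entry_le (R : realType) (n : nat) (i j k l : 'I_n) :
  `|plane_gen R i j k l| <= 2.
Proof.
rewrite /plane_gen !mxE; apply: le_trans (ler_normB _ _) _.
have -> : 2 = 1 + 1 :> R by [].
by apply: lerD; rewrite normr_nat; case: (_ && _); rewrite ?ler01.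
Qed.

Lemma orthogonal_entry_le (R : realType) (n : nat) (V : 'M[R]_n) (i j : 'I_n) :
  orthogonal_group V -> `|V i j| <= 1.
Proof.
move=> VV; have := entry_le_enorm (col j V) i; rewrite mxE => /le_trans; apply.
rewrite -(ler_pXn2r (ltn0Sn 1)) ?nnegrE ?enorm_ge0// expr1n sqr_enorm.
rewrite sqfrob_trace colE trmx_mul -mulmxA (mulmxA V^T) (VV : _ = _) mul1mx.
by rewrite trmx_delta mul_delta_mx /mxtrace big_ord1 mxE !eqxx.
Qed.

(* D is the directional derivative of the observable. Since u = O(s^2), the other
   terms of its increment d are O(s^2). *)
Lemma quadratic_increment_le (R : realType) (D F G H K b s u : R) :
  0 <= s <= 1 -> 0 <= u -> u <= s ^+ 2 -> `|D| <= 2 * b -> `|F| <= 2 * b ->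
  `|G| <= b -> `|H| <= 2 * b -> `|K| <= b ->
  let d := s * D + u * F + s ^+ 2 * G + s * u * H + u ^+ 2 * K in
  `|d| <= 8 * b * s /\ d ^+ 2 <= s ^+ 2 * D ^+ 2 + 60 * b ^+ 2 * s ^+ 3.
Proof.
move=> /andP[s0 s1] u0 us Db Fb Gb Hb Kb d.
have b0 : 0 <= b by apply: le_trans Gb.
pose E := u * F + s ^+ 2 * G + s * u * H + u ^+ 2 * K.
have dE : d = s * D + E by rewrite /d /E; ring.
have s20 : 0 <= s ^+ 2 by exact: sqr_ge0.
have s2s : s ^+ 2 <= s by nra.
have suu : 0 <= s * u <= s ^+ 2 by nra.
have uu : 0 <= u ^+ 2 <= s ^+ 2 by nra.
have term (x y c : R) : 0 <= x <= s ^+ 2 -> `|y| <= c -> `|x * y| <= s ^+ 2 * c.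
  by move=> /andP[x0 xs] yc; rewrite normrM (ger0_norm x0) ler_pM.
(* The four terms contribute 2 + 1 + 2 + 1 = 6. Then |d| <= 2 b s + 6 b s^2, and the excess in d^2
   is at most 24 b^2 s^3 + 36 b^2 s^4, whence the constants 8 and 60. *)
have E6 : `|E| <= 6 * b * s ^+ 2.
  have h1 : `|u * F| <= s ^+ 2 * (2 * b) by apply: term; rewrite ?u0.
  have h2 : `|s ^+ 2 * G| <= s ^+ 2 * b by apply: term; rewrite ?s20 ?lexx.
  have h3 : `|s * u * H| <= s ^+ 2 * (2 * b) by exact: term.
  have h4 : `|u ^+ 2 * K| <= s ^+ 2 * b by exact: term.
  have n1 := ler_normD (u * F + s ^+ 2 * G + s * u * H) (u ^+ 2 * K).
  have n2 := ler_normD (u * F + s ^+ 2 * G) (s * u * H).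
  have n3 := ler_normD (u * F) (s ^+ 2 * G).
  by rewrite /E; lra.
have sD : `|s * D| <= 2 * b * s by rewrite normrM (ger0_norm s0) mulrC ler_pM.
split.
  rewrite dE; apply: le_trans (ler_normD _ _) _.
  by have := ler_wpM2l b0 s2s; lra.
have -> : d ^+ 2 = s ^+ 2 * D ^+ 2 + (2 * (s * D) * E + E ^+ 2).
  by rewrite dE; ring.
rewrite lerD2l; apply: le_trans (ler_norm _) _.
apply: le_trans (ler_normD _ _) _; rewrite normrM normrX.
have h1 : `|2 * (s * D)| * `|E| <= (2 * (2 * b * s)) * (6 * b * s ^+ 2).
  by rewrite normrM ler_pM// normr_nat ler_pM.
have h2 : `|E| ^+ 2 <= (6 * b * s ^+ 2) * (6 * b * s ^+ 2).
  by rewrite expr2 ler_pM.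
have h3 := ler_wpM2l (mulr_ge0 (sqr_ge0 b) (mulr_ge0 s20 s0)) s1.
by lra.
Qed.

Definition trace_obs (R : realType) (n : nat) (M C V : 'M[R]_n) : R :=
  \tr (M *m V *m C *m V^T) - \tr M * \tr C / n%:R.

Lemma trace_obsE (R : realType) (n : nat) (M C V Q : 'M[R]_n) :
  trace_obs M C (Q *m V) =
  btr M (V *m C *m V^T) Q Q - \tr M * \tr C / n%:R.
Proof. by rewrite /trace_obs /btr trmx_mul !mulmxA. Qed.

Lemma plane_rot_estimates (R : realType) (n : nat) (M C : 'M[R]_n) :
  (0 < n)%N -> M^T = M -> C^T = C ->
  exists2 L : R, 0 <= L &
  forall (s u : R) (V : 'M[R]_n), 0 <= s <= 1 -> 0 <= u -> u <= s ^+ 2 ->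
    s ^+ 2 = 2 * u - u ^+ 2 -> orthogonal_group V ->
  [/\ forall i j,
        `|trace_obs M C (plane_rot s u i j *m V) - trace_obs M C V| <= L * s,
      \sum_i \sum_j
        (trace_obs M C (plane_rot s u i j *m V) - trace_obs M C V) ^+ 2
      <= s ^+ 2 * (16 * (opnorm C ^+ 2 * sqfrob M)) + L * s ^+ 3 &
      `|\sum_i \sum_j (trace_obs M C V *+ 2
          - trace_obs M C (plane_rot s u i j *m V)
          - trace_obs M C (plane_rot (- s) u i j *m V))
        - s ^+ 2 * (4 * n%:R) * trace_obs M C V| <= L * s ^+ 4].
Proof.
move=> n0 MT CT.
have [m m0 Mm] := mx_entries_bounded M; have [g g0 Cg] := mx_entries_bounded C.
pose nn : R := n%:R; have nn0 : 0 <= nn by exact: ler0n.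
(* [c] bounds the entries of the identity, of a generator (at most 2) and of its square (at most 4
   n); [x] bounds those of V C V^T, as entries of V are at most 1; [b] then bounds every [btr]
   term. *)
pose c : R := 2 + nn * 4; have c0 : 0 <= c by rewrite /c; lra.
pose x : R := nn * (nn * (1 * g) * 1); have x0 : 0 <= x by rewrite !mulr_ge0.
pose b := n%:R ^+ 4 * (m * x * c ^+ 2).
have b0 : 0 <= b by rewrite !mulr_ge0// exprn_ge0.
have p1 : 0 <= 8 * b by rewrite mulr_ge0.
have p2 : 0 <= nn ^+ 2 * (60 * b ^+ 2) by rewrite !mulr_ge0// exprn_ge0.
have p3 : 0 <= 4 * nn * b by rewrite !mulr_ge0.
have p4 : 0 <= 2 * (nn ^+ 2 * b) by rewrite !mulr_ge0// exprn_ge0.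
exists (8 * b + nn ^+ 2 * (60 * b ^+ 2) + 4 * nn * b + 2 * (nn ^+ 2 * b)).
  by rewrite !addr_ge0.
move=> s u V s01 u0 us su VV.
have /andP[s0 s1] := s01.
pose X := V *m C *m V^T.
have XT : X^T = X by rewrite /X !trmx_mul trmxK CT mulmxA.
have VT : orthogonal_group V^T.
  by rewrite /orthogonal_group /= trmxK; exact: orthogonal_group_tr.
have Xx i j : `|X i j| <= x.
  apply: mulmx_entry_le; first by rewrite !mulr_ge0.
    by apply: mulmx_entry_le => // k l; exact: orthogonal_entry_le.
  by move=> k l; exact: orthogonal_entry_le.
have trX : \tr X = \tr C.
  by rewrite /X mxtrace_mulC mulmxA (VV : _ = _) mul1mx.
have btr_b (P S : 'M[R]_n) : (forall i j, `|P i j| <= c) -> (forall i j, `|S i j| <= c) ->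
  `|btr M X P S| <= b by move=> Pc Sc; exact: btr_le.
have c1 i j : `|(1%:M : 'M[R]_n) i j| <= c.
  apply: (@le_trans _ _ 1); last by rewrite /c; lra.
  by rewrite mxE normr_nat; case: (_ == _); rewrite ?ler01.
have cA (i j k l : 'I_n) : `|plane_gen R i j k l| <= c.
  by apply: (le_trans (plane_gen_entry_le _ _ _ _ _)); rewrite /c; lra.
have cA2 (i j k l : 'I_n) : `|(plane_gen R i j *m plane_gen R i j) k l| <= c.
  have two0 : 0 <= 2 :> R by [].
  have := mulmx_entry_le two0 (plane_gen_entry_le R i j)
    (plane_gen_entry_le R i j) k l.
  by move=> /le_trans; apply; rewrite /c -/nn; lra.
have obs1 : trace_obs M C V = btr M X 1%:M 1%:M - \tr M * \tr C / n%:R.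
  by rewrite -trace_obsE mul1mx.
have add2 (P S P' S' : 'M[R]_n) :
    (forall i j, `|P i j| <= c) -> (forall i j, `|S i j| <= c) ->
    (forall i j, `|P' i j| <= c) -> (forall i j, `|S' i j| <= c) ->
  `|btr M X P S + btr M X P' S'| <= 2 * b.
  move=> h1 h2 h3 h4; apply: le_trans (ler_normD _ _) _.
  by have := btr_b _ _ h1 h2; have := btr_b _ _ h3 h4; lra.
have sum_const (y : R) : \sum_(i < n) \sum_(j < n) y = nn ^+ 2 * y.
  by rewrite !sumr_const !card_ord -mulrnA -[LHS]mulr_natl natrM.
pose D i j := btr M X (plane_gen R i j) 1%:M + btr M X 1%:M (plane_gen R i j).
have incr i j :
  let d := trace_obs M C (plane_rot s u i j *m V) - trace_obs M C V in
  `|d| <= 8 * b * s /\ d ^+ 2 <= s ^+ 2 * D i j ^+ 2 + 60 * b ^+ 2 * s ^+ 3.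
  move=> d; pose A := plane_gen R i j; pose A2 := A *m A; pose I := 1%:M : 'M[R]_n.
  have -> : d = s * D i j + u * (btr M X A2 I + btr M X I A2)
      + s ^+ 2 * btr M X A A + s * u * (btr M X A A2 + btr M X A2 A)
      + u ^+ 2 * btr M X A2 A2.
    by rewrite /d obs1 trace_obsE -/X btr_rot /= -/A -/A2 -/I /D -/A -/I; ring.
  have cA' : forall k l, `|A k l| <= c := cA i j.
  have cA2' : forall k l, `|A2 k l| <= c := cA2 i j.
  by apply: (quadratic_increment_le s01 u0 us);
     [apply: add2|apply: add2|apply: btr_b|apply: add2|apply: btr_b].
split.
- move=> i j; have [+ _] := incr i j; move=> /le_trans; apply.
  by apply: ler_wpM2r => //; lra.
- apply: (@le_trans _ _ (\sum_(i < n) \sum_(j < n)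
    (s ^+ 2 * D i j ^+ 2 + 60 * b ^+ 2 * s ^+ 3))).
    by apply: ler_sum => i _; apply: ler_sum => j _; have [_] := incr i j.
  under eq_bigr do rewrite big_split /= -mulr_sumr.
  rewrite big_split /= -mulr_sumr sum_const; apply: lerD.
    apply: ler_wpM2l; first exact: sqr_ge0.
    apply: (le_trans (sum_btr_grad XT MT)); apply: ler_wpM2l => //.
    (* Orthogonal factors leave the Frobenius norm unchanged: V is dropped on the left of C, and V^T
       M is replaced by M once C has been bounded by its operator norm. *)
    rewrite /X -mulmxA -mulmxA sqfrob_mul_orthogonal//.
    by rewrite -(sqfrob_mul_orthogonal M VT) sqfrob_mul_le.
  have -> : nn ^+ 2 * (60 * b ^+ 2 * s ^+ 3) = nn ^+ 2 * (60 * b ^+ 2) * s ^+ 3 by ring.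
  by apply: ler_wpM2r; [exact: exprn_ge0|lra].
- have -> : \sum_i \sum_j (trace_obs M C V *+ 2
          - trace_obs M C (plane_rot s u i j *m V)
          - trace_obs M C (plane_rot (- s) u i j *m V)) =
    \sum_i \sum_j (btr M X 1%:M 1%:M *+ 2
     - btr M X (plane_rot s u i j) (plane_rot s u i j)
     - btr M X (plane_rot (- s) u i j) (plane_rot (- s) u i j)).
    apply: eq_bigr => i _; apply: eq_bigr => j _.
    by rewrite obs1 !trace_obsE -/X; ring.
  rewrite sum_btr_rot// trX.
  have btr1 : btr M X 1%:M 1%:M = \tr (M *m X) by rewrite /btr trmx1 !mulmx1.
  rewrite obs1 btr1 addrC addKr normrM normrX (ger0_norm u0).
  have us4 : u ^+ 2 <= s ^+ 4.
    have -> : s ^+ 4 = (s ^+ 2) ^+ 2 by ring.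
    by rewrite ler_sqr ?nnegrE ?sqr_ge0.
  rewrite mulrC; apply: ler_pM => //; first exact: sqr_ge0.
  apply: (@le_trans _ _ (4 * nn * b + 2 * (nn ^+ 2 * b))); last lra.
  apply: le_trans (ler_normB _ _) _; apply: lerD.
    rewrite -btr1 normrM; apply: ler_pM => //; last exact: btr_b.
    rewrite normrM normr_nat ler_wpM2l// ger0_norm ?gerBl//.
    by rewrite subr_ge0 ler1n.
  rewrite normrM normr_nat ler_wpM2l//.
  rewrite -sum_const.
  apply: le_trans (ler_norm_sum _ _ _) _; apply: ler_sum => i _.
  apply: le_trans (ler_norm_sum _ _ _) _; apply: ler_sum => j _.
  exact: btr_b.
Qed.

(** * Level inequality *)

(** Closed under the algebraic operations and integrable for every probability, this class
    discharges all integrability side conditions below. *)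
Definition bounded_measurable d (T : measurableType d) (R : realType)
    (f : T -> R) : Prop :=
  measurable_fun [set: T] f /\ exists K, forall x, `|f x| <= K.

Lemma bounded_measurableD d (T : measurableType d) (R : realType) (f g : T -> R) :
  bounded_measurable f -> bounded_measurable g ->
  bounded_measurable (fun x => f x + g x).
Proof.
move=> [mf [K fK]] [mg [L gL]]; split; first exact: measurable_funD.
by exists (K + L) => x; rewrite (le_trans (ler_normD _ _))// lerD.
Qed.

Lemma bounded_measurableM d (T : measurableType d) (R : realType) (f g : T -> R) :
  bounded_measurable f -> bounded_measurable g ->
  bounded_measurable (fun x => f x * g x).
Proof.
move=> [mf [K fK]] [mg [L gL]]; split; first exact: measurable_funM.
by exists (K * L) => x; rewrite normrM ler_pM.
Qed.

Lemma bounded_measurable_cst d (T : measurableType d) (R : realType) (k : R) :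
  bounded_measurable (fun _ : T => k).
Proof. by split; [exact: measurable_cst|exists `|k|]. Qed.

Lemma bounded_measurableB d (T : measurableType d) (R : realType) (f g : T -> R) :
  bounded_measurable f -> bounded_measurable g ->
  bounded_measurable (fun x => f x - g x).
Proof.
move=> [mf [K fK]] [mg [L gL]]; split; first exact: measurable_funB.
by exists (K + L) => x; rewrite (le_trans (ler_normB _ _))// lerD.
Qed.

Lemma bounded_measurable_comp d d' (T : measurableType d) (T' : measurableType d')
    (R : realType) (f : T' -> R) (phi : T -> T') :
  bounded_measurable f -> measurable_fun [set: T] phi ->
  bounded_measurable (fun x => f (phi x)).
Proof.
move=> [mf [K fK]] mphi; split; last by exists K => x.
exact: measurableT_comp.
Qed.

Lemma bounded_measurable_sum d (T : measurableType d) (R : realType)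
    (I : Type) (r : seq I) (F : I -> T -> R) :
  (forall i, bounded_measurable (F i)) ->
  bounded_measurable (fun x => \sum_(i <- r) F i x).
Proof.
move=> bF; elim: r => [|i r IHr].
  by under eq_fun do rewrite big_nil; exact: bounded_measurable_cst.
by under eq_fun do rewrite big_cons; exact: bounded_measurableD.
Qed.

Lemma bounded_measurable_indic d (T : measurableType d) (R : realType)
    (A : set T) :
  measurable A -> bounded_measurable (\1_A : T -> R).
Proof.
move=> mA; split; first exact: measurable_indic.
by exists 1 => x; rewrite indicE normr_nat; case: (_ \in _); rewrite ?ler01.
Qed.

Lemma bounded_measurable_integrable d (T : measurableType d) (R : realType)
    (mu : probability T R) (f : T -> R) :
  bounded_measurable f -> mu.-integrable [set: T] (EFin \o f).
Proof.
move=> [mf [K fK]]; apply: measurable_bounded_integrable => //.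
  by rewrite (le_lt_trans (probability_le1 _ _)) ?ltry.
exists K; split; first exact: num_real.
by move=> M KM x _ /=; rewrite (le_trans (fK x))// ltW.
Qed.

Lemma bounded_RintegralD d (T : measurableType d) (R : realType)
    (mu : probability T R) (f g : T -> R) :
  bounded_measurable f -> bounded_measurable g ->
  \int[mu]_x (f x + g x) = \int[mu]_x f x + \int[mu]_x g x.
Proof.
by move=> bf bg; rewrite RintegralD//; exact: bounded_measurable_integrable.
Qed.

Lemma bounded_RintegralB d (T : measurableType d) (R : realType)
    (mu : probability T R) (f g : T -> R) :
  bounded_measurable f -> bounded_measurable g ->
  \int[mu]_x (f x - g x) = \int[mu]_x f x - \int[mu]_x g x.
Proof.
by move=> bf bg; rewrite RintegralB//; exact: bounded_measurable_integrable.
Qed.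

Lemma Rintegral_sum d (T : measurableType d) (R : realType)
    (mu : probability T R) (I : Type) (r : seq I) (F : I -> T -> R) :
  (forall i, bounded_measurable (F i)) ->
  \int[mu]_x (\sum_(i <- r) F i x) = \sum_(i <- r) \int[mu]_x F i x.
Proof.
move=> bF; elim: r => [|i r IHr].
  under eq_Rintegral do rewrite big_nil.
  by rewrite Rintegral_cst// mul0r big_nil.
under eq_Rintegral do rewrite big_cons.
rewrite big_cons -IHr RintegralD//; apply: bounded_measurable_integrable => //.
exact: bounded_measurable_sum.
Qed.

Lemma Rintegral_indic d (T : measurableType d) (R : realType)
    (mu : probability T R) (A : set T) :
  measurable A -> \int[mu]_x \1_A x = fine (mu A).
Proof. by move=> mA; rewrite /Rintegral integral_indic// setIT. Qed.

Lemma Rintegral_probability_cst d (T : measurableType d) (R : realType)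
    (mu : probability T R) (k : R) : \int[mu]_x k = k.
Proof.
rewrite Rintegral_cst//; transitivity (k * fine (1%:E : \bar R)); last exact: mulr1.
by congr (_ * fine _); exact: probability_setT.
Qed.

Lemma Rintegral_invariant d (T : measurableType d) (R : realType)
    (mu : probability T R) (phi : T -> T) (f : T -> R) :
  measurable_fun [set: T] phi ->
  (forall A, measurable A -> mu (phi @^-1` A) = mu A) ->
  bounded_measurable f ->
  \int[mu]_x f (phi x) = \int[mu]_x f x.
Proof.
move=> mphi inv bf; rewrite /Rintegral; congr fine.
have := @integral_pushforward _ _ _ _ _ phi mphi mu setT (EFin \o f).
rewrite preimage_setT => <-//.
- by apply: eq_measure_integral => A mA _; exact: inv.
- by apply/measurable_EFinP; case: bf.
- by apply: bounded_measurable_integrable; exact: bounded_measurable_comp.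
Qed.

(* Discrete integration by parts: as phi preserves mu, E[(f o phi)(h o phi)] =
   E[f h] and E[f (h o phi)] = E[(f o phi^-1) h]. *)
Lemma Rintegral_exchange d (T : measurableType d) (R : realType)
    (mu : probability T R) (phi phi' : T -> T) (f h : T -> R) :
  measurable_fun [set: T] phi -> measurable_fun [set: T] phi' ->
  (forall A, measurable A -> mu (phi @^-1` A) = mu A) ->
  cancel phi phi' ->
  bounded_measurable f -> bounded_measurable h ->
  \int[mu]_x ((f (phi x) - f x) * (h (phi x) - h x)) =
  \int[mu]_x ((f x *+ 2 - f (phi x) - f (phi' x)) * h x).
Proof.
move=> mphi mphi' inv phiK bf bh.
have bp := bounded_measurable_comp bf mphi.
have bp' := bounded_measurable_comp bf mphi'.
have bhp := bounded_measurable_comp bh mphi.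
have EB := @bounded_RintegralB _ T R mu.
have ED := @bounded_RintegralD _ T R mu.
have bM := @bounded_measurableM _ T R.
have bB := @bounded_measurableB _ T R.
have bD := @bounded_measurableD _ T R.
transitivity (\int[mu]_x (f (phi x) * h (phi x)) - \int[mu]_x (f (phi x) * h x)
  - (\int[mu]_x (f x * h (phi x)) - \int[mu]_x (f x * h x))).
  under eq_Rintegral do rewrite mulrBl !mulrBr.
  by rewrite EB ?EB//; do ?[apply: bB]; apply: bM.
have -> : \int[mu]_x (f (phi x) * h (phi x)) = \int[mu]_x (f x * h x).
  by apply: (@Rintegral_invariant _ _ _ mu phi (fun x => f x * h x)) => //; exact: bM.
have -> : \int[mu]_x (f x * h (phi x)) = \int[mu]_x (f (phi' x) * h x).
  rewrite -(@Rintegral_invariant _ _ _ mu phi (fun x => f (phi' x) * h x))//.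
    by under [RHS]eq_Rintegral do rewrite phiK.
  exact: bM.
under [RHS]eq_Rintegral do rewrite mulr2n !mulrBl mulrDl.
rewrite EB; [|by do ?[apply: bB|apply: bD]; apply: bM|exact: bM].
rewrite EB; [|by apply: bD; apply: bM|exact: bM].
by rewrite ED; [ring|exact: bM..].
Qed.

(** * Level sets and ramps *)

Lemma measurable_norm_gt d (T : measurableType d) (R : realType) (f : T -> R)
    (a : R) :
  measurable_fun [set: T] f -> measurable [set x | a < `|f x|].
Proof.
move=> mf; rewrite (_ : mkset _ = [set: T] `&` (fun x => `|f x|) @^-1` `]a, +oo[).
  by apply: measurableT_comp => //; exact: measurable_itv.
by rewrite setTI; apply/seteqP; split=> x /=; rewrite in_itv/= andbT.
Qed.

Lemma measurable_norm_itv d (T : measurableType d) (R : realType) (f : T -> R)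
    (a b : R) :
  measurable_fun [set: T] f -> measurable [set x | a < `|f x| <= b].
Proof.
move=> mf; rewrite (_ : mkset _ = [set: T] `&` (fun x => `|f x|) @^-1` `]a, b]).
  by apply: measurableT_comp => //; exact: measurable_itv.
by rewrite setTI; apply/seteqP; split=> x /=; rewrite in_itv.
Qed.

Definition clip (R : realType) (r x : R) : R := Num.max (- r) (Num.min r x).

(* Odd, 1-Lipschitz, zero on [-a, a] and constant beyond [-b, b]. *)
Definition ramp (R : realType) (a b x : R) : R := clip b x - clip a x.

Lemma clipP (R : realType) (r x : R) : 0 <= r ->
  [\/ x <= - r /\ clip r x = - r, - r <= x <= r /\ clip r x = x
    | r <= x /\ clip r x = r].
Proof.
move=> r0; rewrite /clip; have [rx|xr] := leP r x.
  by apply: Or33; split=> //; apply/max_idPr; lra.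
have [rx|xr'] := leP (- r) x; last by apply: Or31; rewrite ltW.
by apply: Or32; split=> //; rewrite (ltW xr).
Qed.

Lemma ramp_lipschitz (R : realType) (a b x y : R) :
  0 <= a <= b -> (x - y) * (ramp a b x - ramp a b y) <= (x - y) ^+ 2.
Proof.
move=> /andP[a0 ab]; have b0 := le_trans a0 ab.
wlog yx : x y / y <= x.
  move=> H; have [/H //|/ltW /H] := leP y x.
  by rewrite -(opprB x y) -(opprB (ramp a b x)) mulrNN sqrrN.
have : ramp a b x - ramp a b y <= x - y.
  by rewrite /ramp; have [[? ->]|[? ->]|[? ->]] := clipP x a0;
     have [[? ->]|[? ->]|[? ->]] := clipP x b0;
     have [[? ->]|[? ->]|[? ->]] := clipP y a0;
     have [[? ->]|[? ->]|[? ->]] := clipP y b0; lra.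
move=> H; rewrite expr2; apply: ler_wpM2l => //; lra.
Qed.

Lemma ramp_eq0 (R : realType) (a b x : R) :
  0 <= a <= b -> `|x| <= a -> ramp a b x = 0.
Proof.
move=> /andP[a0 ab]; rewrite ler_norml => /andP[ax xa].
by rewrite /ramp; have [[? ->]|[? ->]|[? ->]] := clipP x a0;
  have [[? ->]|[? ->]|[? ->]] := clipP x (le_trans a0 ab); lra.
Qed.

Lemma ramp_ge (R : realType) (a b x : R) :
  0 <= a <= b -> b <= x -> ramp a b x = b - a.
Proof.
move=> /andP[a0 ab] bx.
by rewrite /ramp; have [[? ->]|[? ->]|[? ->]] := clipP x a0;
  have [[? ->]|[? ->]|[? ->]] := clipP x (le_trans a0 ab); lra.
Qed.

Lemma ramp_le (R : realType) (a b x : R) :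
  0 <= a <= b -> x <= - b -> ramp a b x = - (b - a).
Proof.
move=> /andP[a0 ab] xb.
by rewrite /ramp; have [[? ->]|[? ->]|[? ->]] := clipP x a0;
  have [[? ->]|[? ->]|[? ->]] := clipP x (le_trans a0 ab); lra.
Qed.

Lemma norm_ramp_le (R : realType) (a b x : R) :
  0 <= a <= b -> `|ramp a b x| <= b - a.
Proof.
move=> /andP[a0 ab]; rewrite ler_norml; apply/andP.
by rewrite /ramp; have [[? ->]|[? ->]|[? ->]] := clipP x a0;
  have [[? ->]|[? ->]|[? ->]] := clipP x (le_trans a0 ab); split; lra.
Qed.

Lemma ramp_mul_ge0 (R : realType) (a b x : R) :
  0 <= a <= b -> 0 <= x * ramp a b x.
Proof.
move=> /andP[a0 ab]; have [x0|x0] := leP 0 x.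
  by apply: mulr_ge0 => //; rewrite /ramp;
  have [[? ->]|[? ->]|[? ->]] := clipP x a0;
  have [[? ->]|[? ->]|[? ->]] := clipP x (le_trans a0 ab); lra.
by apply: mulr_le0; [exact: ltW|]; rewrite /ramp;
  have [[? ->]|[? ->]|[? ->]] := clipP x a0;
  have [[? ->]|[? ->]|[? ->]] := clipP x (le_trans a0 ab); lra.
Qed.

Lemma measurable_ramp (R : realType) (a b : R) :
  measurable_fun [set: R] (ramp a b).
Proof.
have mclip r : measurable_fun [set: R] (clip r).
  by apply: measurable_maxr => //; exact: measurable_minr.
exact: measurable_funB.
Qed.

(* The margin e makes both ramp values agree as soon as |x| is outside ]a, b]. *)
Lemma ramp_increment_le (R : realType) (a b e x y : R) :
  0 <= a -> a + e <= b - e -> `|y - x| <= e ->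
  (y - x) * (ramp (a + e) (b - e) y - ramp (a + e) (b - e) x)
  <= (y - x) ^+ 2 * ((a < `|x|) && (`|x| <= b))%:R.
Proof.
move=> a0 ab yx.
have e0 : 0 <= e by apply: le_trans yx.
have aeb : 0 <= a + e <= b - e by apply/andP; split; lra.
move: yx; rewrite ler_norml => /andP[yx1 yx2].
have [ax /=|xa /=] := ltP a `|x|; last first.
  rewrite mulr0 !ramp_eq0 ?subrr ?mulr0//; first lra.
  by move: xa; rewrite !ler_norml => /andP[? ?]; apply/andP; split; lra.
have [xb|bx] := leP `|x| b; first by rewrite mulr1; exact: ramp_lipschitz.
rewrite mulr0; have [x0|x0] := leP 0 x.
  by rewrite ger0_norm// in bx; rewrite !ramp_ge ?subrr ?mulr0//; lra.
by rewrite ltr0_norm// in bx; rewrite !ramp_le ?subrr ?mulr0//; lra.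
Qed.

(** The fixed-angle version, obtained by bounding one integral from both sides with h the ramp of f.
    The second difference is c f up to r, and f h is nonnegative everywhere and at least b (b - a -
    2 e) where |f| > b: this is the lower bound. For the upper bound, an increment of h contributes
    only at points where |f| lies in ]a, b]. *)
Lemma level_inequality_perturbed d (T : measurableType d) (R : realType)
    (mu : probability T R) (I : finType) (f : T -> R) (phi phi' : I -> T -> T)
    (a b e c v r : R) :
  bounded_measurable f ->
  (forall i, measurable_fun [set: T] (phi i)) ->
  (forall i, measurable_fun [set: T] (phi' i)) ->
  (forall i A, measurable A -> mu (phi i @^-1` A) = mu A) ->
  (forall i, cancel (phi i) (phi' i)) ->
  0 <= a -> a + e <= b - e -> 0 <= c -> 0 <= r ->
  (forall i x, `|f (phi i x) - f x| <= e) ->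
  (forall x, \sum_i (f (phi i x) - f x) ^+ 2 <= v) ->
  (forall x, `|\sum_i (f x *+ 2 - f (phi i x) - f (phi' i x)) - c * f x| <= r) ->
  0 <= e ->
  c * (b * (b - a - 2 * e)) * fine (mu [set x | b < `|f x|])
  <= v * fine (mu [set x | a < `|f x| <= b]) + r * (b - a).
Proof.
move=> bf mphi mphi' inv phiK a0 ab c0 r0 He Hv Hr e0.
have aeb : 0 <= a + e <= b - e by apply/andP; split; lra.
pose h x := ramp (a + e) (b - e) (f x).
have bh : bounded_measurable h.
  split; last by exists (b - e - (a + e)) => x; exact: norm_ramp_le.
  by apply: measurableT_comp; [exact: measurable_ramp|case: bf].
have mf : measurable_fun [set: T] f by case: bf.
have mG := measurable_norm_gt b mf; have mA := measurable_norm_itv a b mf.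
set G := [set x | _] in mG *; set A := [set x | _] in mA *.
have bphi i := bounded_measurable_comp bf (mphi i).
have bphi' i := bounded_measurable_comp bf (mphi' i).
have bhphi i := bounded_measurable_comp bh (mphi i).
have bM := @bounded_measurableM _ T R.
have bB := @bounded_measurableB _ T R.
have bD := @bounded_measurableD _ T R.
have bc := @bounded_measurable_cst _ T R.
have bL i : bounded_measurable
    (fun x => (f (phi i x) - f x) * (h (phi i x) - h x)).
  by apply: bM; apply: bB.
have bR i : bounded_measurable
    (fun x => (f x *+ 2 - f (phi i x) - f (phi' i x)) * h x).
  by apply: bM => //; do 2 ?apply: bounded_measurableB => //; exact: bD.
have key : \int[mu]_x (\sum_i (f (phi i x) - f x) * (h (phi i x) - h x)) =
           \int[mu]_x (\sum_i (f x *+ 2 - f (phi i x) - f (phi' i x)) * h x).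
  rewrite !Rintegral_sum//; apply: eq_bigr => i _.
  exact: (Rintegral_exchange (mphi i) (mphi' i) (inv i) (phiK i) bf bh).
have int F : bounded_measurable F -> mu.-integrable [set: T] (EFin \o F).
  exact: bounded_measurable_integrable.
have bG := bounded_measurable_indic R mG.
have bA := bounded_measurable_indic R mA.
have lower : c * (b * (b - a - 2 * e)) * fine (mu G) - r * (b - a) <=
    \int[mu]_x (\sum_i (f x *+ 2 - f (phi i x) - f (phi' i x)) * h x).
  have -> : c * (b * (b - a - 2 * e)) * fine (mu G) - r * (b - a) =
      \int[mu]_x (c * (b * (b - a - 2 * e)) * \1_G x - r * (b - a)).
    rewrite bounded_RintegralB//; last exact: bM.
    rewrite RintegralZl//; last exact: int.
    by rewrite Rintegral_indic// Rintegral_probability_cst.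
  apply: le_Rintegral => //.
  - by apply: int; apply: bB => //; exact: bM.
  - by apply: int; exact: bounded_measurable_sum.
  move=> x _; rewrite -mulr_suml; set S := \sum_i _.
  have hb : `|h x| <= b - a.
    by apply: le_trans (norm_ramp_le _ aeb) _; lra.
  have Sh : c * f x * h x - r * (b - a) <= S * h x.
    have : `|(S - c * f x) * h x| <= r * (b - a).
      by rewrite normrM; apply: ler_pM => //; exact: Hr.
    by rewrite ler_norml => /andP[+ _]; rewrite mulrBl; lra.
  apply: le_trans Sh; rewrite lerD2r -!(mulrA c) ler_wpM2l// indicE.
  have fh0 : 0 <= f x * h x by exact: ramp_mul_ge0.
  have [/set_mem bfx|_] := boolP (x \in G); last by rewrite mulr0.
  rewrite /G /= in bfx.
  rewrite mulr1; have [x0|x0] := leP 0 (f x).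
    rewrite ger0_norm// in bfx; rewrite /h ramp_ge//; last lra.
    have -> : b - e - (a + e) = b - a - 2 * e by ring.
    by apply: ler_wpM2r; lra.
  rewrite ltr0_norm// in bfx; rewrite /h ramp_le//; last lra.
  have -> : f x * - (b - e - (a + e)) = - f x * (b - a - 2 * e) by ring.
  by apply: ler_wpM2r; lra.
have upper : \int[mu]_x (\sum_i (f (phi i x) - f x) * (h (phi i x) - h x)) <=
    v * fine (mu A).
  rewrite -Rintegral_indic// -RintegralZl//; last exact: int.
  apply: le_Rintegral => //.
  - by apply: int; exact: bounded_measurable_sum.
  - by apply: int; exact: bM.
  move=> x _; rewrite indicE.
  apply: (@le_trans _ _ (\sum_i (f (phi i x) - f x) ^+ 2 * (x \in A)%:R)).
    apply: ler_sum => i _; have -> : (x \in A) = ((a < `|f x|) && (`|f x| <= b)).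
      by rewrite /A mem_setE.
    exact: ramp_increment_le.
  by rewrite -mulr_suml ler_wpM2r.
by move: lower; rewrite -key; lra.
Qed.

(** The limit s -> 0 of the perturbed inequality with e = L s: after division by s^2 all errors are
    at most [k * s]. *)
Lemma level_inequality d (T : measurableType d) (R : realType)
    (mu : probability T R) (I : finType) (f : T -> R)
    (phi phi' : R -> I -> T -> T) (a b c v L : R) :
  bounded_measurable f ->
  (forall s i, 0 < s <= 1 -> measurable_fun [set: T] (phi s i)) ->
  (forall s i, 0 < s <= 1 -> measurable_fun [set: T] (phi' s i)) ->
  (forall s i A, 0 < s <= 1 -> measurable A -> mu (phi s i @^-1` A) = mu A) ->
  (forall s i, 0 < s <= 1 -> cancel (phi s i) (phi' s i)) ->
  (forall s i x, 0 < s <= 1 -> `|f (phi s i x) - f x| <= L * s) ->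
  (forall s x, 0 < s <= 1 ->
    \sum_i (f (phi s i x) - f x) ^+ 2 <= s ^+ 2 * v + L * s ^+ 3) ->
  (forall s x, 0 < s <= 1 ->
    `|\sum_i (f x *+ 2 - f (phi s i x) - f (phi' s i x)) - s ^+ 2 * c * f x|
    <= L * s ^+ 4) ->
  0 <= c -> 0 <= L -> 0 <= a < b ->
  c * (b * (b - a)) * fine (mu [set x | b < `|f x|])
  <= v * fine (mu [set x | a < `|f x| <= b]).
Proof.
move=> bf mphi mphi' inv phiK H1 H2 H3 c0 L0 /andP[a0 ab].
set G := fine _; set p := fine _.
have G0 : 0 <= G by exact: fine_ge0.
have p0 : 0 <= p by exact: fine_ge0.
pose k := c * (b * (2 * L)) * G + L * p + L * (b - a).
have k0 : 0 <= k.
  by rewrite /k !addr_ge0// !mulr_ge0//; lra.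
have small s : 0 < s <= 1 -> 2 * (L * s) <= b - a ->
    c * (b * (b - a)) * G <= v * p + k * s.
  move=> s01 sL; have /andP[s0 s1] := s01.
  have s2 : 0 < s ^+ 2 by rewrite exprn_gt0.
  have := @level_inequality_perturbed _ T R mu I f (phi s) (phi' s) a b (L * s)
    (s ^+ 2 * c) (s ^+ 2 * v + L * s ^+ 3) (L * s ^+ 4) bf.
  move=> /(_ _ _ _ _ a0) H.
  have {H} : s ^+ 2 * c * (b * (b - a - 2 * (L * s))) * G <=
      (s ^+ 2 * v + L * s ^+ 3) * p + L * s ^+ 4 * (b - a).
    apply: H => // [i|i|i A|i||||i x|x|x|].
    - exact: mphi.
    - exact: mphi'.
    - exact: inv.
    - exact: phiK.
    - lra.
    - by rewrite mulr_ge0// ltW.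
    - by rewrite mulr_ge0// exprn_ge0// ltW.
    - exact: H1.
    - exact: H2.
    - exact: H3.
    - by rewrite mulr_ge0// ltW.
  have -> : s ^+ 2 * c * (b * (b - a - 2 * (L * s))) * G =
     s ^+ 2 * (c * (b * (b - a - 2 * (L * s))) * G) by ring.
  have -> : (s ^+ 2 * v + L * s ^+ 3) * p + L * s ^+ 4 * (b - a) =
     s ^+ 2 * (v * p + L * s * p + L * s ^+ 2 * (b - a)) by ring.
  rewrite ler_pM2l// => H.
  have ss : s ^+ 2 <= s by rewrite expr2 ler_piMr// ltW.
  have Lba : 0 <= L * (b - a) by rewrite mulr_ge0//; lra.
  by have := ler_wpM2l Lba ss; rewrite /k; lra.
apply/ler_addgt0Pr => e e0.
(* This step size keeps the two margins inside ]a, b] and makes the error at most [e]; adding 1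
   keeps the denominators positive. *)
pose q := Num.min 1 (Num.min ((b - a) / (2 * L + 1)) (e / (k + 1))).
have l1 : 0 < 2 * L + 1 by lra.
have k1 : 0 < k + 1 by lra.
have q0 : 0 < q by rewrite /q !lt_min ltr01 !divr_gt0// subr_gt0.
have q1 : q <= 1 by rewrite /q ge_min lexx.
have q2 : q <= (b - a) / (2 * L + 1) by rewrite /q !ge_min lexx !orbT.
have q3 : q <= e / (k + 1) by rewrite /q !ge_min lexx !orbT.
move: q2 q3; rewrite !ler_pdivlMr// => q2 q3.
apply: (le_trans (small q _ _)); [by rewrite q0|lra|].
by rewrite lerD2l; lra.
Qed.

(** * From level inequalities to Gaussian tails *)

(** With levels j h and z_j = k h^2 j, each step divides G by at least 1 + z_j, which is at least
    exp(z_j / 2) when z_j <= 1. The z_j add up to k h^2 N (N + 1) / 2 >= k t^2 / 2; halving them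
    leaves k t^2 / 4. *)
Lemma gaussian_decay (R : realType) (G : R -> R) (k t : R) :
  (forall x, 0 <= G x <= 1) -> 0 <= k -> 0 < t ->
  (forall a b, 0 <= a < b -> k * (b * (b - a)) * G b <= G a - G b) ->
  G t <= expR (- (k * t ^+ 2 / 4)).
Proof.
move=> G01 k0 t0 step.
have kt0 : 0 <= k * t ^+ 2 by rewrite mulr_ge0// sqr_ge0.
(* N >= k t^2 makes every z at most k h^2 N = k t^2 / N <= 1, as the exponential comparison
   requires. *)
pose N := (Num.bound (k * t ^+ 2)).+1.
have NP : k * t ^+ 2 <= N%:R.
  rewrite ltW// (lt_le_trans (archi_boundP kt0))// ler_nat.
  exact: leqnSn.
have N0 : 0 < N%:R :> R by rewrite ltr0n.
pose h := t / N%:R.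
have h0 : 0 < h by rewrite divr_gt0.
have hN : N%:R * h = t by rewrite /h mulrC divfK// gt_eqF.
have khN : k * h ^+ 2 * N%:R <= 1.
  have -> : k * h ^+ 2 * N%:R = (k * t ^+ 2) / N%:R.
    by rewrite -hN; field; rewrite gt_eqF.
  by rewrite ler_pdivrMr// mul1r.
have kh0 : 0 <= k * h ^+ 2 by rewrite mulr_ge0// sqr_ge0.
have main j : (j <= N)%N ->
    G (j%:R * h) <= expR (- (k * h ^+ 2 * (j%:R * (j%:R + 1)) / 4)).
  elim: j => [_|j IH jN].
    rewrite !mul0r mulr0 mul0r oppr0 expR0; have /andP[_] := G01 0; exact.
  have jNR : j.+1%:R <= N%:R :> R by rewrite ler_nat.
  move: jNR; rewrite -natr1; have := IH (ltnW jN).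
  have : 0 <= j%:R :> R by exact: ler0n.
  move: (j%:R : R) => x x0 {}IH xN.
  pose z := k * h ^+ 2 * (x + 1).
  have z0 : 0 <= z by rewrite mulr_ge0// addr_ge0.
  have z1 : z <= 1 by apply: le_trans khN; apply: ler_wpM2l.
  have Gb0 : 0 <= G ((x + 1) * h) by case/andP: (G01 ((x + 1) * h)).
  have xh : 0 <= x * h < (x + 1) * h.
    by rewrite mulr_ge0 ?(ltW h0)//= ltr_pM2r// ltrDl.
  have Gstep : (1 + z) * G ((x + 1) * h) <= G (x * h).
    have := step _ _ xh.
    have -> : k * ((x + 1) * h * ((x + 1) * h - x * h)) = z by rewrite /z; ring.
    by lra.
  have E1 : 1 <= (1 + z) * expR (- (z / 2)).
    apply: (@le_trans _ _ ((1 + z) * (1 + - (z / 2)))); first by nra.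
    by apply: ler_wpM2l; [lra|exact: expR_ge1Dx].
  have -> : - (k * h ^+ 2 * ((x + 1) * (x + 1 + 1)) / 4) =
      - (z / 2) + - (k * h ^+ 2 * (x * (x + 1)) / 4) by rewrite /z; field.
  rewrite expRD; apply: (@le_trans _ _ (expR (- (z / 2)) * G (x * h))).
    apply: (@le_trans _ _ (expR (- (z / 2)) * ((1 + z) * G ((x + 1) * h)))).
      by rewrite mulrA -[leLHS]mul1r (mulrC (expR _)) ler_wpM2r.
    by apply: ler_wpM2l => //; exact: expR_ge0.
  by apply: ler_wpM2l => //; exact: expR_ge0.
have := main N (leqnn N); rewrite hN => /le_trans; apply.
rewrite ler_expR lerN2 -{1}hN.
have -> : k * (N%:R * h) ^+ 2 / 4 = k * h ^+ 2 * (N%:R * N%:R) / 4 by ring.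
rewrite ler_pM2r; last by rewrite invr_gt0.
by apply: ler_wpM2l => //; apply: ler_wpM2l; [exact: ltW|rewrite lerDl].
Qed.

(** * Haar measure *)

Lemma measurable_open_mx (R : realType) (n : nat) (O : set 'M[R]_n) :
  open O -> measurable (O : set (borelM R n)).
Proof. by move=> oO; exact: sub_sigma_algebra. Qed.

Lemma measurable_entry (R : realType) (n : nat) (i j : 'I_n) :
  measurable_fun [set: borelM R n] (fun V : borelM R n => (V : 'M[R]_n) i j).
Proof.
apply: (measurability _ (RGenOpens.measurableE R)).
move=> _ [_ [x [y ->]] <-]; rewrite setTI; apply: measurable_open_mx.
have /continuousP := @coord_continuous R n n i j; apply.
exact: interval_open.
Qed.

Definition measurable_mx d (T : measurableType d) (R : realType) (m n : nat)
    (F : T -> 'M[R]_(m, n)) : Prop :=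
  forall i j, measurable_fun [set: T] (fun x => F x i j).

Lemma measurable_mx_mul d (T : measurableType d) (R : realType) (m n p : nat)
    (F : T -> 'M[R]_(m, n)) (H : T -> 'M[R]_(n, p)) :
  measurable_mx F -> measurable_mx H -> measurable_mx (fun x => F x *m H x).
Proof.
move=> mF mH i j; under eq_fun do rewrite mxE.
by apply: measurable_sum => k; exact: measurable_funM.
Qed.

Lemma measurable_mx_tr d (T : measurableType d) (R : realType) (m n : nat)
    (F : T -> 'M[R]_(m, n)) :
  measurable_mx F -> measurable_mx (fun x => (F x)^T).
Proof. by move=> mF i j; under eq_fun do rewrite mxE; exact: mF. Qed.

Lemma measurable_mx_cst d (T : measurableType d) (R : realType) (m n : nat)
    (B : 'M[R]_(m, n)) : measurable_mx (fun _ : T => B).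
Proof. by move=> i j; exact: measurable_cst. Qed.

Lemma measurable_mx_id (R : realType) (n : nat) :
  measurable_mx (fun V : borelM R n => (V : 'M[R]_n)).
Proof. by move=> i j; exact: measurable_entry. Qed.

Lemma measurable_trace_obs (R : realType) (n : nat) (M C : 'M[R]_n) :
  measurable_fun [set: borelM R n] (trace_obs M C).
Proof.
apply: measurable_funB => //; apply: measurable_sum => i.
have mid := @measurable_mx_id R n.
have mc B := @measurable_mx_cst _ (borelM R n) R n n B.
do 3 ?[apply: measurable_mx_mul => //].
exact: measurable_mx_tr.
Qed.

Lemma measurable_orthogonal_group (R : realType) (n : nat) :
  measurable (@orthogonal_group R n : set (borelM R n)).
Proof.
pose f (V : borelM R n) := sqfrob ((V : 'M[R]_n)^T *m V - 1%:M).
have mf : measurable_fun [set: borelM R n] f.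
  apply: measurable_sum => i; apply: measurable_sum => j.
  apply: measurable_funX; under eq_fun do rewrite mxE.
  apply: measurable_funD => //.
  apply: measurable_mx_mul; last exact: measurable_mx_id.
  by apply: measurable_mx_tr; exact: measurable_mx_id.
rewrite (_ : @orthogonal_group R n = [set: borelM R n] `&` f @^-1` [set 0]).
  by apply: mf => //; exact: measurable_set1.
rewrite setTI; apply/seteqP; split=> V /=; rewrite /f.
  move=> ->; rewrite subrr /sqfrob big1// => i _.
  by rewrite big1// => j _; rewrite mxE expr0n.
by move=> /sqfrob_eq0 /eqP; rewrite subr_eq0 => /eqP.
Qed.

Lemma continuous_mulmxl (R : realType) (n : nat) (Q : 'M[R]_n) :
  continuous (fun V : 'M[R]_n => Q *m V).
Proof.
move=> V O [P VP PO].
have cont_entry i j : continuous (fun W : 'M[R]_n => (Q *m W) i j).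
  under eq_fun do rewrite mxE.
  have addc : continuous (fun x : R * R => x.1 + x.2).
    by move=> x; apply: cvgD; [exact: cvg_fst|exact: cvg_snd].
  apply: (continuous_big addc) => k _ W.
  apply: (@continuous_comp _ _ _ (fun W : 'M[R]_n => W k j) ( *%R (Q i k))).
    exact: coord_continuous.
  exact: mulrl_continuous.
have FV : Filter (nbhs V) by exact: nbhs_filter.
(* A neighbourhood of a matrix contains a product of neighbourhoods of its entries; being finitely
   many, the entrywise conditions hold together near V. *)
have H : \forall W \near V, forall i j, P i j ((Q *m W) i j).
  apply: (@filter_forall _ _ (fun i W => forall j, P i j ((Q *m W) i j)) _ FV).
  move=> i.
  apply: (@filter_forall _ _ (fun j W => P i j ((Q *m W) i j)) _ FV) => j.
  exact: (cont_entry i j V _ (VP i j)).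
by apply: filterS H => W; exact: PO.
Qed.

Lemma measurable_mulmxl (R : realType) (n : nat) (Q : 'M[R]_n) :
  measurable_fun [set: borelM R n] (fun V => Q *m (V : 'M[R]_n) : borelM R n).
Proof.
apply: (@measurability _ _ (borelM R n) (borelM R n) setT _ (@open 'M[R]_n)) => //.
move=> _ [B oB <-]; rewrite setTI; apply: measurable_open_mx.
by have /continuousP := @continuous_mulmxl R n Q; apply.
Qed.

Lemma orthogonal_group_mul (R : realType) (n : nat) (Q V : 'M[R]_n) :
  orthogonal_group Q -> orthogonal_group (Q *m V) <-> orthogonal_group V.
Proof.
move=> QQ; rewrite /orthogonal_group /= trmx_mul -mulmxA (mulmxA Q^T).
by rewrite (QQ : _ = _) mul1mx.
Qed.

(** Invariance is stated for images; the preimage of B under Q is its image under Q^T. *)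
Lemma haar_preimage (R : realType) (n : nat) (mu : probability (borelM R n) R)
    (Q : 'M[R]_n) (B : set (borelM R n)) :
  is_haar_orthogonal mu -> orthogonal_group Q -> measurable B ->
  mu ((fun V => Q *m (V : 'M[R]_n) : borelM R n) @^-1` B) = mu B.
Proof.
move=> [_ inv] QQ mB; have QQ' := orthogonal_group_tr QQ.
have QT : orthogonal_group Q^T by rewrite /orthogonal_group /= trmxK.
rewrite -(inv Q^T B QT mB); congr (mu _); apply/seteqP; split=> V /=.
  by move=> BV; exists (Q *m V) => //; rewrite mulmxA (QQ : _ = _) mul1mx.
by move=> [W BW <-]; rewrite mulmxA QQ' mul1mx.
Qed.

(** * The trace observable under Haar measure *)

(** The nonnegative root selects the angle in [0, pi/2], so that u = O(s^2); the other root would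
    keep u away from 0. *)
Definition angle_versine (R : realType) (s : R) : R := 1 - Num.sqrt (1 - s ^+ 2).

Lemma angle_versineP (R : realType) (s : R) : 0 < s <= 1 ->
  let u := angle_versine s in
  [/\ 0 <= u, u <= s ^+ 2 & s ^+ 2 = 2 * u - u ^+ 2].
Proof.
move=> /andP[s0 s1] u.
have s20 : 0 <= s ^+ 2 := sqr_ge0 s.
have s21 : s ^+ 2 <= 1 by nra.
have w2 : Num.sqrt (1 - s ^+ 2) ^+ 2 = 1 - s ^+ 2 by rewrite sqr_sqrtr// subr_ge0.
have w0 : 0 <= Num.sqrt (1 - s ^+ 2) := sqrtr_ge0 _.
have w1 : Num.sqrt (1 - s ^+ 2) <= 1.
  by rewrite -[leRHS]sqrtr1; apply: ler_wsqrtr; lra.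
rewrite /u /angle_versine; move: w2 w0 w1; set w := Num.sqrt _ => w2 w0 w1.
have ww : 0 <= w * (1 - w) by rewrite mulr_ge0// subr_ge0.
by split; [lra|lra|rewrite -[LHS](subKr 1) -w2; ring].
Qed.

(* Cut off outside O(n) so as to be bounded everywhere. *)
Definition obs_on_orthogonal (R : realType) (n : nat) (M C : 'M[R]_n)
    (V : borelM R n) : R :=
  trace_obs M C V * \1_(@orthogonal_group R n) V.

Lemma bounded_measurable_obs (R : realType) (n : nat) (M C : 'M[R]_n) :
  bounded_measurable (obs_on_orthogonal M C).
Proof.
split.
  apply: measurable_funM; first exact: measurable_trace_obs.
  by apply: measurable_indic; exact: measurable_orthogonal_group.
have [m m0 Mm] := mx_entries_bounded M; have [g g0 Cg] := mx_entries_bounded C.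
exists (n%:R ^+ 4 * (m * g * 1 ^+ 2) + `|\tr M * \tr C / n%:R|) => V.
rewrite /obs_on_orthogonal indicE.
have [/set_mem VV|_] := boolP (_ \in _); last first.
  by rewrite mulr0 normr0 addr_ge0// !mulr_ge0// exprn_ge0.
rewrite mulr1; apply: le_trans (ler_normB _ _) _; rewrite lerD2r.
apply: (@btr_le R n M C V V) => //.
  by move=> i j; exact: orthogonal_entry_le.
by move=> i j; exact: orthogonal_entry_le.
Qed.

Lemma obs_level_inequality (R : realType) (n : nat) (M C : 'M[R]_n)
    (mu : probability (borelM R n) R) (a b : R) :
  (0 < n)%N -> M^T = M -> C^T = C -> is_haar_orthogonal mu -> 0 <= a < b ->
  4 * n%:R * (b * (b - a)) * fine (mu [set V | b < `|obs_on_orthogonal M C V|])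
  <= 16 * (opnorm C ^+ 2 * sqfrob M)
     * fine (mu [set V | a < `|obs_on_orthogonal M C V| <= b]).
Proof.
move=> n0 MT CT haar ab.
have [L L0 HL] := plane_rot_estimates n0 MT CT.
pose Q s (p : 'I_n * 'I_n) := plane_rot s (angle_versine s) p.1 p.2 : 'M[R]_n.
pose Q' s (p : 'I_n * 'I_n) := plane_rot (- s) (angle_versine s) p.1 p.2 : 'M[R]_n.
have QO s p : 0 < s <= 1 -> orthogonal_group (Q s p).
  by move=> /angle_versineP[_ _ su]; exact: plane_rot_orthogonal.
have Q'O s p : 0 < s <= 1 -> orthogonal_group (Q' s p).
  by move=> /angle_versineP[_ _ su]; apply: plane_rot_orthogonal; rewrite sqrrN.
(* Multiplication by an orthogonal P preserves O(n) and its complement, so the cut-off factor is the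
   same at V and P V. Each estimate thus reduces to the one on O(n), or to a bound on 0 off it. *)
have obsQ V (P : 'M[R]_n) : orthogonal_group P -> 
    obs_on_orthogonal M C (P *m V) =
    trace_obs M C (P *m V) * \1_(@orthogonal_group R n) V.
  move=> PO; rewrite /obs_on_orthogonal !indicE; congr (_ * (_ : bool)%:R).
  by apply/idP/idP => /set_mem H; apply/mem_set; apply/(orthogonal_group_mul V PO).
have s01W (s : R) : 0 < s <= 1 -> 0 <= s <= 1 by move=> /andP[/ltW -> ->].
apply: (@level_inequality _ _ R mu _ (obs_on_orthogonal M C)
  (fun s p V => Q s p *m V) (fun s p V => Q' s p *m V) a b (4 * n%:R)
  (16 * (opnorm C ^+ 2 * sqfrob M)) L) => //.
- exact: bounded_measurable_obs.
- by move=> s p _; exact: measurable_mulmxl.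
- by move=> s p _; exact: measurable_mulmxl.
- by move=> s p A s01 mA; apply: haar_preimage => //; exact: QO.
- move=> s p s01 V; rewrite mulmxA /Q' -plane_rot_tr.
  by rewrite (QO s p s01 : _ = _) mul1mx.
- move=> s p V s01; have /andP[s0 _] := s01; have [u0 us su] := angle_versineP s01.
  rewrite obsQ; last exact: QO.
  rewrite /obs_on_orthogonal -mulrBl indicE.
  have [/set_mem VV|_] := boolP (_ \in _); last first.
    by rewrite mulr0 normr0 mulr_ge0// ltW.
  by rewrite mulr1; have [H _ _] := HL s _ V (s01W s s01) u0 us su VV; exact: H.
- move=> s V s01; have /andP[s0 _] := s01; have [u0 us su] := angle_versineP s01.
  under eq_bigr => p _ do rewrite (obsQ V _ (QO s p s01)) /obs_on_orthogonal
    -mulrBl exprMn.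
  rewrite -mulr_suml indicE.
  have [/set_mem VV|_] := boolP (_ \in _); last first.
    rewrite expr0n mulr0; apply: addr_ge0.
      by rewrite mulr_ge0 ?sqr_ge0// mulr_ge0// mulr_ge0 ?sqr_ge0 ?sqfrob_ge0.
    by rewrite mulr_ge0// exprn_ge0// ltW.
  rewrite expr1n mulr1; have [_ H _] := HL s _ V (s01W s s01) u0 us su VV.
  by rewrite pair_big in H.
- move=> s V s01; have /andP[s0 _] := s01; have [u0 us su] := angle_versineP s01.
  under eq_bigr => p _ do rewrite (obsQ V _ (QO s p s01))
    (obsQ V _ (Q'O s p s01)) /obs_on_orthogonal -mulrnAl -!mulrBl.
  rewrite -mulr_suml /obs_on_orthogonal mulrA -mulrBl indicE.
  have [/set_mem VV|_] := boolP (_ \in _); last first.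
    by rewrite mulr0 normr0 mulr_ge0// exprn_ge0// ltW.
  rewrite mulr1; have [_ _ H] := HL s _ V (s01W s s01) u0 us su VV.
  by rewrite pair_big in H.
Qed.

Lemma tail_difference d (T : measurableType d) (R : realType)
    (mu : probability T R) (f : T -> R) (a b : R) :
  measurable_fun [set: T] f -> a < b ->
  fine (mu [set x | a < `|f x| <= b]) =
  fine (mu [set x | a < `|f x|]) - fine (mu [set x | b < `|f x|]).
Proof.
move=> mf ab; have mA := measurable_norm_itv a b mf.
have mG := measurable_norm_gt b mf.
have -> : [set x | a < `|f x|] = [set x | a < `|f x| <= b] `|` [set x | b < `|f x|].
  apply/seteqP; split=> x /=; last by move=> [/andP[]|/(lt_trans ab)].
  by move=> ax; have [xb|bx] := leP `|f x| b; [left; rewrite ax|right].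
rewrite measureU//; last first.
  by apply/seteqP; split=> x //= [/andP[_ /le_lt_trans H] /H]; rewrite ltxx.
by rewrite fineD ?fin_num_measure// addrK.
Qed.

(** The gradient bound can vanish, for instance when M = 0; replacing it by a positive [v] makes the
    rate 4 n / v meaningful. *)
Lemma obs_concentration (R : realType) (n : nat) (M C : 'M[R]_n)
    (mu : probability (borelM R n) R) (v t : R) :
  (0 < n)%N -> M^T = M -> C^T = C -> is_haar_orthogonal mu ->
  0 < v -> 16 * (opnorm C ^+ 2 * sqfrob M) <= v -> 0 < t ->
  fine (mu [set V | t < `|obs_on_orthogonal M C V|]) <=
  expR (- (4 * n%:R / v * t ^+ 2 / 4)).
Proof.
move=> n0 MT CT haar v0 Hv t0.
have [mf _] := bounded_measurable_obs M C.
apply: (@gaussian_decay R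
  (fun t => fine (mu [set V | t < `|obs_on_orthogonal M C V|]))) => //.
- move=> x; rewrite fine_ge0//=; have mx := measurable_norm_gt x mf.
  by rewrite -lee_fin fineK ?fin_num_measure// probability_le1.
- by rewrite divr_ge0// ?mulr_ge0// ltW.
move=> a b ab; have /andP[a0 altb] := ab.
rewrite -tail_difference//.
have := obs_level_inequality n0 MT CT haar ab.
set p := fine (mu [set V | a < _ <= b]); set G := fine _ => H.
have p0 : 0 <= p by exact: fine_ge0.
have : 4 * n%:R * (b * (b - a)) * G <= v * p.
  by apply: le_trans H _; exact: ler_wpM2r.
have -> : 4 * n%:R / v * (b * (b - a)) * G =
  (4 * n%:R * (b * (b - a)) * G) / v by rewrite -!mulrA; ring.
by rewrite ler_pdivrMr// (mulrC p).
Qed.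

Theorem theorem1 (R : realType) :
  exists kappa : R, 0 < kappa /\
  forall (n m : nat) (eps : R) (C : 'M[R]_n) (A : 'M[R]_(m, n)),
    (0 < n)%N -> (0 < m)%N -> 0 < eps -> symposdef C ->
  forall (d : measure_display) (T : measurableType d) (P : probability T R)
    (U : {RV P >-> borelM R n}),
    is_haar_orthogonal (distribution P U) ->
    ((1 - expR (- (kappa * (n%:R - 1) * eps ^+ 2)))%:E <=
     P [set w | let V : 'M[R]_n := U w in
          (`| ntrace (A *m V *m C *m V^T *m A^T)
             - ntrace C * ntrace (A *m A^T) |
          <= 2 * eps * opnorm C * opnorm (A *m A^T))%R])%E.
Proof.
(* With t = 2 eps m K and v = 16 m K^2, the exponent (4 n / v) t^2 / 4 equals n m eps^2 / 4, which
   dominates (n - 1) eps^2 / 4. *)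
exists (4^-1); split; first by rewrite invr_gt0.
move=> n m eps C A n0 m0 eps0 [CT _] d T P U haar.
pose mu : probability (borelM R n) R := distribution P U.
pose M := A^T *m A.
pose K := opnorm C * opnorm (A *m A^T).
have MT : M^T = M by rewrite trmx_mul trmxK.
have mR0 : 0 < m%:R :> R by rewrite ltr0n.
have nR1 : 1 <= n%:R :> R by rewrite ler1n.
(* By cyclicity of the trace the normalised difference is the observable divided by m, hence the
   factor m in the threshold. *)
pose t := 2 * eps * m%:R * K.
pose S := [set V : borelM R n | `|trace_obs M C V| <= t].
have event : [set w | let V : 'M[R]_n := U w in
    `|ntrace (A *m V *m C *m V^T *m A^T) - ntrace C * ntrace (A *m A^T)|
    <= 2 * eps * opnorm C * opnorm (A *m A^T)] = U @^-1` S.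
  apply/seteqP; suff H (V : 'M[R]_n) :
      (`|ntrace (A *m V *m C *m V^T *m A^T) - ntrace C * ntrace (A *m A^T)|
       <= 2 * eps * opnorm C * opnorm (A *m A^T)) = (`|trace_obs M C V| <= t).
    by split=> w /=; rewrite H.
  have -> : ntrace (A *m V *m C *m V^T *m A^T) - ntrace C * ntrace (A *m A^T)
      = trace_obs M C V / m%:R.
    rewrite /ntrace /trace_obs /M (mxtrace_mulC _ A^T) (mxtrace_mulC A A^T).
    by rewrite !mulmxA; field; rewrite !gt_eqF// (lt_le_trans ltr01).
  rewrite normrM normfV (gtr0_norm mR0) ler_pdivrMr//.
  by congr (_ <= _); rewrite /t /K; ring.
rewrite event; have -> : P (U @^-1` S) = mu S by [].
have mobs := measurable_trace_obs M C.
have mS : measurable S.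
  rewrite (_ : S = ~` [set V : borelM R n | t < `|trace_obs M C V|]).
    by apply: measurableC; exact: measurable_norm_gt.
  by apply/seteqP; split=> V /=; rewrite /S /= leNgt => /negP.
have K0 : 0 <= K by rewrite mulr_ge0 ?opnorm_ge0.
(* When K = 0 the threshold and the gradient bound both degenerate; but then C = 0 or A = 0, and the
   observable is identically zero. *)
have [K00|Kpos] := eqVneq K 0.
  have obs0 V : trace_obs M C V = 0.
    have opnorm_eq0 k (B : 'M[R]_k) : opnorm B = 0 -> B = 0.
      move=> B0; apply: sqfrob_eq0; apply/eqP; rewrite eq_le sqfrob_ge0 andbT.
      by apply: le_trans (sqfrob_le_opnorm B) _; rewrite B0 expr0n mulr0.
    have [/opnorm_eq0 C0|/opnorm_eq0 A0] : opnorm C = 0 \/ opnorm (A *m A^T) = 0.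
      by move/eqP: K00; rewrite mulf_eq0 => /orP[/eqP|/eqP]; [left|right].
      by rewrite /trace_obs C0 mulmx0 mul0mx !mxtrace0 mulr0 mul0r subrr.
    have {}A0 : A = 0.
      apply: sqfrob_eq0.
      by rewrite sqfrob_trace mxtrace_mulC A0 mxtrace0.
    by rewrite /trace_obs /M A0 mulmx0 !mul0mx !mxtrace0 !mul0r subrr.
  have -> : S = [set: borelM R n].
    by apply/seteqP; split=> V //= _; rewrite /S /= obs0 normr0 /t K00 mulr0.
  by rewrite probability_setT lee_fin gerBl expR_ge0.
have {Kpos}Kpos : 0 < K by rewrite lt_def Kpos.
have t0 : 0 < t by apply: mulr_gt0 => //; rewrite !mulr_gt0.
pose v := 16 * (m%:R * K ^+ 2).
have v0 : 0 < v by apply: mulr_gt0 => //; apply: mulr_gt0 => //; exact: exprn_gt0.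
have Hv : 16 * (opnorm C ^+ 2 * sqfrob M) <= v.
  (* tr((A^T A)^2) = tr((A A^T)^2): passing to the m x m side makes the dimension factor m and
     brings in the operator norm of A A^T. *)
  have -> : sqfrob M = sqfrob (A *m A^T).
    by rewrite !sqfrob_trace !trmx_mul !trmxK /M -mulmxA mxtrace_mulC !mulmxA.
  rewrite /v /K exprMn (mulrCA m%:R); apply: ler_wpM2l => //.
  by apply: ler_wpM2l; [exact: sqr_ge0|exact: sqfrob_le_opnorm].
have := obs_concentration n0 MT CT haar v0 Hv t0; rewrite -/mu.
set B := [set V | _] => HB.
have [mf _] := bounded_measurable_obs M C.
have mB : measurable B by exact: measurable_norm_gt.
have mO := @measurable_orthogonal_group R n.
(* The concentration bound concerns the cut-off observable, which agrees with [trace_obs] on O(n);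
   the complement is null. *)
have muOC : mu (~` @orthogonal_group R n) = 0%E.
  by rewrite probability_setC// (haar.1 : mu _ = _) subee.
have muSC : (mu (~` S) <= mu B)%E.
  apply: (@le_trans _ _ (mu (B `|` ~` @orthogonal_group R n))).
    apply: le_measure; rewrite ?inE.
    - exact: measurableC.
    - by apply: measurableU => //; exact: measurableC.
    move=> V /= SV; have [VO|VO] := pselect (orthogonal_group V); last by right.
    left; rewrite /B /= /obs_on_orthogonal indicE mem_set// mulr1 ltNge.
    by apply/negP.
  have U2 : (mu (B `|` ~` @orthogonal_group R n)
      <= mu B + mu (~` @orthogonal_group R n))%E.
    by apply: measureU2 => //; exact: measurableC.
  by rewrite muOC adde0 in U2.
have muS : mu S = (1 - mu (~` S))%E.
  by rewrite -probability_setC ?setCK//; exact: measurableC.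
rewrite muS EFinB leeB//; apply: (le_trans muSC).
rewrite -(fineK (fin_num_measure mu B mB)) lee_fin; apply: (le_trans HB).
rewrite ler_expR lerN2.
have -> : 4 * n%:R / v * t ^+ 2 / 4 = 4^-1 * (n%:R * m%:R) * eps ^+ 2.
  by rewrite /v /t; field; rewrite !gt_eqF.
rewrite ler_wpM2r ?sqr_ge0// ler_wpM2l ?invr_ge0//.
have m1 : 1 <= m%:R :> R by rewrite ler1n.
by nra.
Qed.
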